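(* Let $a,b\in\mathbb R\setminus\{0\}$, $a<b$. Assume that $t,s>0$ satisfy $t\ne s$, $at\ne bs$ and $bt\ne as$. Then, under the sine-process, as $N\to\infty$, $$\operatorname{Cov}(\#_{[aNt,bNt]},\#_{[aNs,bNs]})\to\pi^{-1}\big(\mathcal G(at,as)+\mathcal G(bt,bs)-\mathcal G(at,bs)-\mathcal G(bt,as)\big),$$ where $\mathcal G(x,y)=-\frac1{2\pi}\ln|x-y|$.
   Context: The sine-process is the determinantal point process on $\mathbb R$ (a probability measure on the space of locally finite configurations of particles in $\mathbb R$) with $n$-point correlation functions $\rho_n(x_1,\dots,x_n)=\det(\mathcal K(x_i,x_j))_{1\le i,j\le n}$, where $\mathcal K(x,y)=\frac{\sin(x-y)}{\pi(x-y)}$ for $x\ne y$ and $\mathcal K(x,x)=\frac1\pi$. $\#_B$ is the number of particles of the random configuration in $B$. *)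

(* Defs.v *)
From HB Require Import structures.
From mathcomp Require Import all_boot all_order all_algebra.
From mathcomp Require Import finmap.
From mathcomp Require Import all_classical all_reals all_analysis measurable_realfun.

Set Implicit Arguments.
Unset Strict Implicit.
Unset Printing Implicit Defensive.

Import Order.TTheory GRing.Theory Num.Theory.
Import numFieldTopology.Exports numFieldNormedType.Exports.

Local Open Scope classical_set_scope.
Local Open Scope ring_scope.

(* Particles of a configuration are pairwise distinct: a configuration is a
   locally finite subset of the line. *)
Record configuration (R : realType) := Configuration {
  particles : set R;
  locally_finite : forall K : set R, compact K -> finite_set (particles `&` K)
}.

Section configuration_instances.
Variable R : realType.

HB.instance Definition _ := gen_eqMixin (configuration R).
HB.instance Definition _ := gen_choiceMixin (configuration R).

Lemma locally_finite_set0 (K : set R) :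
  compact K -> finite_set ((set0 : set R) `&` K).
Proof. by move=> _; rewrite set0I; exact: finite_set0. Qed.

HB.instance Definition _ :=
  isPointed.Build (configuration R) (Configuration locally_finite_set0).

End configuration_instances.

(* Only meaningful when [B] is bounded: [fset_set] sends an infinite set to
   the empty one. *)
Definition num_particles (R : realType) (B : set R) (X : configuration R) : R :=
  (#|` fset_set (particles X `&` B)|)%:R.

Definition counting_events (R : realType) : set (set (configuration R)) :=
  [set E | exists B : set R, exists k : nat,
     [/\ measurable B, bounded_set B & E = [set X | num_particles B X = k%:R]]].

Definition conf_space (R : realType) :=
  g_sigma_algebraType (@counting_events R).

Definition distinct_tuples (R : realType) (n : nat) (X : configuration R) :
    set (n.-tuple R) :=
  [set x : n.-tuple R | uniq x /\ forall i, particles X (tnth x i)].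
Arguments distinct_tuples {R} n X.

(* For a nonnegative measurable [f] this is, by Tonelli, the integral of [f]
   with respect to the [n]-dimensional Lebesgue measure. *)
Fixpoint tuple_integral (R : realType) (n : nat) :
    (n.-tuple R -> \bar R) -> \bar R :=
  match n return (n.-tuple R -> \bar R) -> \bar R with
  | 0 => fun f => f [tuple]
  | m.+1 => fun f => (\int[@lebesgue_measure R]_x
      tuple_integral (fun y : m.-tuple R => f (cons_tuple x y)))%E
  end.

(* [rho n] is the density, with respect to Lebesgue measure, of the [n]-th
   factorial moment measure of [P]. *)
Definition has_correlation_functions (R : realType)
    (P : probability (conf_space R) R) (rho : forall n, n.-tuple R -> R) :=
  forall (n : nat) (f : n.-tuple R -> \bar R),
    measurable_fun setT f -> (forall x, (0 <= f x)%E) ->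
    (\int[P]_X (\esum_(x in distinct_tuples n X) f x) =
     tuple_integral (fun x => f x * (rho n x)%:E))%E.

Definition determinantal (R : realType) (P : probability (conf_space R) R)
    (K : R -> R -> R) :=
  has_correlation_functions P
    (fun n x => \det (\matrix_(i < n, j < n) K (tnth x i) (tnth x j))).

Definition sine_kernel (R : realType) (x y : R) : R :=
  if x == y then pi^-1 else sin (x - y) / (pi * (x - y)).

Definition sine_process (R : realType) (P : probability (conf_space R) R) :=
  determinantal P (@sine_kernel R).

Definition log_covariance (R : realType) (x y : R) : R :=
  - (1 / (2 * pi)) * ln `|x - y|.

(* Main.v *)
Require Import Defs.
From mathcomp Require Import all_boot all_order all_algebra.
From mathcomp Require Import finmap.
From mathcomp Require Import ring lra.
From mathcomp Require Import all_classical all_reals all_analysis measurable_realfun.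

(* For intervals I = [p, q] and J = [r, s], the one- and two-point functions give
     Cov(#_I, #_J) = |I n J| / pi - pi^-2 \int_I \int_J sinc^2 (x - y) dy dx,
   and the double integral is a second difference of an even function G with
   G'' = sinc^2. The expansion G u = pi/2 |u| - (ln |u|) / 2 + C + o(1) at infinity
   then yields the limit: the linear terms cancel |I n J| / pi and the logarithms
   remain. The constant pi/2, the integral of sinc^2 over the half-line, comes from
   comparing sinc^2 with the Fejer kernel, and the next-order term from one
   integration by parts. *)

Import Order.TTheory GRing.Theory Num.Theory.
Import numFieldTopology.Exports numFieldNormedType.Exports.

Set Implicit Arguments.
Unset Strict Implicit.
Unset Printing Implicit Defensive.

Local Open Scope classical_set_scope.
Local Open Scope ring_scope.

(** * Calculus on the line: derivative rules, comparison of increments, primitives *)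

Section real_derivatives.
Context {R : realType}.
Implicit Types f g : R -> R.

Lemma is_derive_funD f g (x df dg : R) : is_derive x 1 f df ->
  is_derive x 1 g dg -> is_derive x 1 (fun y => f y + g y) (df + dg).
Proof. exact: is_deriveD. Qed.

Lemma is_derive_funB f g (x df dg : R) : is_derive x 1 f df ->
  is_derive x 1 g dg -> is_derive x 1 (fun y => f y - g y) (df - dg).
Proof. exact: is_deriveB. Qed.

Lemma is_derive_funM f g (x df dg : R) : is_derive x 1 f df ->
  is_derive x 1 g dg -> is_derive x 1 (fun y => f y * g y) (f x * dg + g x * df).
Proof. exact: is_deriveM. Qed.

Lemma is_derive_funZ f (x c df : R) : is_derive x 1 f df ->
  is_derive x 1 (fun y => c * f y) (c * df).
Proof. exact: is_deriveZ. Qed.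

Lemma is_derive_fun_comp f g (x df dg : R) : is_derive (g x) 1 f df ->
  is_derive x 1 g dg -> is_derive x 1 (fun y => f (g y)) (df * dg).
Proof. exact: is_derive1_comp. Qed.

Lemma is_derive_mulrl (x c : R) : is_derive x 1 (fun y : R => c * y) c.
Proof. by rewrite -[X in is_derive _ _ _ X]mulr1; apply: is_derive_funZ. Qed.

Lemma is_derive_invX (x : R) n : x != 0 ->
  is_derive x 1 (fun y : R => (y ^+ n)^-1) (- n%:R * (x ^+ n.+1)^-1).
Proof.
move=> x0; have xn0 : x ^+ n != 0 by rewrite expf_neq0.
have dX : is_derive x 1 (fun y : R => y ^+ n) (n%:R * x ^+ n.-1).
  by have := is_deriveX n (is_derive_id x (1 : R)); rewrite exprfctE /GRing.scale/= mulr1.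
have := @is_deriveV R (fun y => y ^+ n) x _ 1 xn0 dX.
rewrite /GRing.scale/=; congr (is_derive _ _ _ _).
case: n xn0 {dX} => [|n] xn0; first by rewrite !mul0r !mulr0 oppr0 mul0r.
by rewrite /= !exprS; field; rewrite x0 expf_neq0.
Qed.

Lemma is_derive_within_continuous f (df : R -> R) (a b : R) :
  (forall x, x \in `[a, b] -> is_derive x 1 f (df x)) ->
  {within `[a, b], continuous f}.
Proof.
move=> fdf; apply: derivable_within_continuous => x xab.
by have := fdf _ xab => -[].
Qed.

(** Mean value theorem for [g - f]. Applied below to explicit primitives, it takes the place of
    integrating an inequality between derivatives. *)
Lemma ler_is_derive_increment f g (df dg : R -> R) (a b : R) : a <= b ->
  (forall x, x \in `[a, b] -> is_derive x 1 f (df x)) ->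
  (forall x, x \in `[a, b] -> is_derive x 1 g (dg x)) ->
  (forall x, a < x < b -> df x <= dg x) ->
  f b - f a <= g b - g a.
Proof.
rewrite le_eqVlt => /predU1P[->|ab] fdf gdg dfg; first by rewrite !subrr.
have hdh x : x \in `[a, b] -> is_derive x 1 (fun y => g y - f y) (dg x - df x).
  by move=> xab; apply: is_derive_funB; [exact: gdg|exact: fdf].
have hoo x : x \in `]a, b[ -> is_derive x 1 (fun y => g y - f y) (dg x - df x).
  by move=> xab; apply: hdh; exact: subset_itv_oo_cc.
have [c cab h] := @MVT R (fun y => g y - f y) (fun y => dg y - df y) a b ab hoo
  (is_derive_within_continuous hdh).
suff: 0 <= (g b - f b) - (g a - f a) by lra.
rewrite h mulr_ge0 ?subr_ge0 ?(ltW ab) ?dfg//.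
Qed.

Lemma continuous_is_derive f (df : R -> R) :
  (forall x : R, is_derive x 1 f (df x)) -> continuous f.
Proof.
move=> dfx x; apply/differentiable_continuous/derivable1_diffP.
by have [] := dfx x.
Qed.

Let mu := @lebesgue_measure R.

Lemma continuous_integrable_itvcc f (a b : R) : continuous f ->
  mu.-integrable `[a, b] (EFin \o f).
Proof.
move=> cf; apply: continuous_compact_integrable; first exact: segment_compact.
exact: continuous_subspaceT.
Qed.

(** The integral starts at [- M] with [M] depending on the endpoint. Subtracting its value at 0
    removes the dependence on [M], so near each point one fixed [M] serves and the fundamental
    theorem of calculus applies. *)
Lemma continuous_primitive f : continuous f ->
  exists F : R -> R, F 0 = 0 /\ forall x : R, is_derive x 1 F (f x).
Proof.
move=> cf.
pose I M (x : R) : R := (\int[mu]_(t in `[(- M)%R, x]) f t)%R.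
have IM M M' x : M <= M' -> - M <= x ->
    I M' x - I M' (- M) = I M x.
  move=> MM' Mx; rewrite /I Rintegral_itvB.
  - rewrite Rintegral_itv_obnd_cbnd//.
    apply: integrableS (continuous_integrable_itvcc (- M) x cf) => //.
    exact: subset_itv_oc_cc.
  - exact: continuous_integrable_itvcc.
  - by rewrite bnd_simp; lra.
  - by rewrite bnd_simp.
pose F x := I (`|x| + 1) x - I (`|x| + 1) 0.
have FM M x : `|x| + 1 <= M -> F x = I M x - I M 0.
  have x0 := normr_ge0 x; have xN := ler_norm (- x); rewrite normrN in xN.
  move=> xM; have h0 : - (`|x| + 1) <= 0 by lra.
  have hx : - (`|x| + 1) <= x by lra.
  by rewrite /F -(IM _ _ _ xM h0) -(IM _ _ _ xM hx) opprB addrA addrNK.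
exists F; split; first by rewrite /F subrr.
(* The margin 2 keeps [|y| + 1 <= M] for every [y] within distance 1 of [x], so that [FM] holds near
   [x] with this one [M]. *)
move=> x; pose M := `|x| + 2.
have Mx : - M < x by have := ler_norm (- x); rewrite normrN /M; lra.
have [dI I'] : derivable (I M) x 1 /\ derive1 (I M) x = f x.
  apply: (@continuous_FTC1_closed _ _ (- M) x (x + 1)) => //.
  - by lra.
  - exact: continuous_integrable_itvcc.
  - exact: cf.
have dIM : is_derive x 1 (fun y => I M y - I M 0) (f x).
  rewrite -[X in is_derive _ _ _ X]subr0; apply: is_derive_funB.
  by rewrite -I' derive1E; exact/derivableP.
refine (@near_eq_is_derive R R R (fun y => I M y - I M 0) F x 1 (f x) _ dIM).
near=> y; rewrite (FM M)// /M.
have : `|x - y| < 1 by near: y; apply: cvgr_dist_lt.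
by have := ler_distD x y 0; rewrite !subr0 distrC; lra.
Unshelve. all: by end_near. Qed.

Lemma FTC2_is_derive (F f : R -> R) (a b : R) : a <= b -> continuous f ->
  (forall x : R, is_derive x 1 F (f x)) ->
  (\int[mu]_(x in `[a, b]) (f x)%:E = (F b - F a)%:E)%E.
Proof.
move=> + cf dF; rewrite le_eqVlt => /predU1P[->|ab].
  by rewrite set_itv1 integral_set1 subrr.
rewrite (continuous_FTC2 ab (F := F))//.
- exact: continuous_subspaceT.
- have cF := continuous_is_derive dF.
  split; [by move=> x _; have [] := dF x| |].
  + exact/cvg_at_right_filter/cF.
  + exact/cvg_at_left_filter/cF.
- by move=> x _; rewrite derive1E; have [_ ->] := dF x.
Qed.

End real_derivatives.

(** * The function [sinc] and its comparison with the Fejer kernel *)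

Section sinc.
Context {R : realType}.
Implicit Types u x : R.

Definition sinc u : R := if u == 0 then 1 else sin u / u.

Lemma sincM u : sinc u * u = sin u.
Proof.
rewrite /sinc; case: eqP => [->|/eqP u0]; first by rewrite mulr0 sin0.
by rewrite divfK.
Qed.

Lemma sincN u : sinc (- u) = sinc u.
Proof. by rewrite /sinc oppr_eq0 sinN invrN mulrNN. Qed.

Lemma sine_kernelE x y : sine_kernel x y = pi^-1 * sinc (x - y).
Proof.
rewrite /sine_kernel /sinc subr_eq0; case: eqP => _; first by rewrite mulr1.
by rewrite invfM mulrCA.
Qed.

Lemma sin_le u : 0 <= u -> sin u <= u.
Proof.
move=> u0.
have := @ler_is_derive_increment R sin id cos (fun=> 1) 0 u u0
  (fun x _ => is_derive_sin x) (fun x _ => is_derive_id x 1) (fun x _ => cos_le1 x).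
by rewrite sin0 !subr0.
Qed.

Lemma continuous_sinc : continuous sinc.
Proof.
move=> u; have [->|u0] := eqVneq u 0; last first.
  have h : {for u, continuous (fun v : R => sin v / v)}.
    apply: cvgM; first exact: continuous_sin.
    exact: cvgV.
  apply: (@cvg_trans _ ((fun v : R => sin v / v) @ u)).
    apply: near_eq_cvg; near=> v.
    have : `|u - v| < `|u| by near: v; apply: cvgr_dist_lt; rewrite // normr_gt0.
    by rewrite /sinc; case: (v =P 0) => // ->; rewrite subr0 ltxx.
  by have -> : sinc u = sin u / u by rewrite /sinc (negbTE u0).
(* At 0 the limit of [sin h / h] is the derivative of [sin], namely [cos 0 = 1]. *)
apply/continuous_withinNx; have -> : sinc 0 = 1 by rewrite /sinc eqxx.
have [d0 dE] := is_derive_sin (0 : R).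
have {d0} : (fun h : R => h^-1 *: (sin (h *: 1 + 0) - sin 0)) @ 0^' --> (1 : R).
  by rewrite -[X in _ --> X]cos0 -dE; exact: d0.
apply: cvg_trans; apply: near_eq_cvg; near=> h.
have h0 : h != 0 by near: h; exact: nbhs_dnbhs_neq.
by rewrite /sinc (negbTE h0) sin0 subr0 addr0 /GRing.scale/= mulr1 mulrC.
Unshelve. all: by end_near. Qed.

(** The left side has derivative [cos x - x * sin x], at most [cos x] since [sin] is nonnegative on
    this range. *)
Lemma mulr_cos_le_sin x : 0 <= x <= pi / 2 -> x * cos x <= sin x.
Proof.
move=> /andP[x0 xpi].
have d1 (y : R) : is_derive y 1 (fun y : R => y * cos y) (y * - sin y + cos y * 1).
  exact: is_derive_funM.
have h := @ler_is_derive_increment R (fun y => y * cos y) sin _ cos 0 x x0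
  (fun x _ => d1 x) (fun x _ => is_derive_sin x).
have {h} : x * cos x - 0 * cos 0 <= sin x - sin 0.
  apply: h => y /andP[y0 yx]; rewrite mulr1 mulrN gerDr oppr_le0 mulr_ge0 ?(ltW y0)//.
  by apply: sin_ge0_pi; have := pi_ge0 R; lra.
by rewrite mul0r sin0 !subr0.
Qed.

(** With doubled frequencies, [dirichlet_kernel n] is sin((2n+1)x) / sin x, and [fejer_kernel n],
    the sum of the first n of them, is (sin(nx) / sin x)^2. Cosine sums avoid the quotient at 0 and
    have primitives in closed form. *)
Fixpoint dirichlet_primitive n x : R := if n is m.+1 then
  dirichlet_primitive m x + m.+1%:R^-1 * sin (m.+1%:R * 2 * x) else x.

Fixpoint dirichlet_kernel n x : R := if n is m.+1 then
  dirichlet_kernel m x + 2 * cos (m.+1%:R * 2 * x) else 1.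

Fixpoint fejer_primitive n x : R := if n is m.+1 then
  fejer_primitive m x + dirichlet_primitive m x else 0.

Fixpoint fejer_kernel n x : R := if n is m.+1 then
  fejer_kernel m x + dirichlet_kernel m x else 0.

Lemma is_derive_dirichlet_primitive n x :
  is_derive x 1 (dirichlet_primitive n) (dirichlet_kernel n x).
Proof.
elim: n => [|n IH]; first exact: is_derive_id.
have -> : dirichlet_kernel n.+1 x = dirichlet_kernel n x +
    n.+1%:R^-1 * (cos (n.+1%:R * 2 * x) * (n.+1%:R * 2)).
  by rewrite /=; congr (_ + _); field; rewrite nat1r pnatr_eq0.
apply: is_derive_funD => //; apply: is_derive_funZ.
exact: (@is_derive_fun_comp _ sin _ x _ _ _ (is_derive_mulrl x _)).
Qed.

Lemma is_derive_fejer_primitive n x :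
  is_derive x 1 (fejer_primitive n) (fejer_kernel n x).
Proof.
elim: n => [|n IH]; first exact: is_derive_cst.
by apply: is_derive_funD => //; exact: is_derive_dirichlet_primitive.
Qed.

(** Telescoping: 2 cos A sin x = sin(A + x) - sin(A - x). *)
Lemma dirichlet_kernelM n x :
  dirichlet_kernel n x * sin x = sin (n%:R * 2 * x + x).
Proof.
elim: n => [|n IH]; first by rewrite !mul0r add0r mul1r.
rewrite [dirichlet_kernel _ _]/= mulrDl IH.
have -> : n%:R * 2 * x + x = n.+1%:R * 2 * x - x by rewrite -natr1; ring.
by rewrite sinB sinD; ring.
Qed.

(** Telescoping again: sin((2n+1)x) sin x = sin^2((n+1)x) - sin^2(nx). *)
Lemma fejer_kernelM n x : fejer_kernel n x * sin x ^+ 2 = sin (n%:R * x) ^+ 2.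
Proof.
elim: n => [|n IH]; first by rewrite !mul0r sin0 expr0n.
rewrite [fejer_kernel _ _]/= mulrDl IH expr2 [X in _ + X]mulrA dirichlet_kernelM.
have -> : n%:R * 2 * x = n%:R * x + n%:R * x by ring.
have -> : n.+1%:R * x = n%:R * x + x by rewrite -natr1; ring.
set A := n%:R * x; have sA := sin2cos2 A; have sx := sin2cos2 x.
rewrite !sinD cosD; move: (sin A) (cos A) (sin x) (cos x) sA sx => a b c d h1 h2.
have -> : (a * d + b * c) ^+ 2 = a ^+ 2 * d ^+ 2 + 2 * a * b * c * d + b ^+ 2 * c ^+ 2.
  by ring.
have -> : d ^+ 2 = 1 - c ^+ 2 by rewrite h2; ring.
have -> : ((a * b + b * a) * d + (b * b - a * a) * c) * c =
  2 * a * b * c * d + b ^+ 2 * c ^+ 2 - a ^+ 2 * c ^+ 2 by ring.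
by ring.
Qed.

Lemma sin_natr_pi n : sin (n%:R * pi : R) = 0.
Proof.
elim: n => [|n IH]; first by rewrite mul0r sin0.
by rewrite -natr1 mulrDl mul1r sinDpi IH oppr0.
Qed.

Lemma dirichlet_primitive_pihalf n : dirichlet_primitive n (pi / 2) = pi / 2.
Proof.
elim: n => //= n ->.
have -> : n.+1%:R * 2 * (pi / 2) = n.+1%:R * pi :> R by field.
by rewrite sin_natr_pi mulr0 addr0.
Qed.

(** The mass of the Fejer kernel on [0, pi/2]: each of its n Dirichlet kernels contributes pi/2,
    because the sine terms vanish at both ends. *)
Lemma fejer_primitive_pihalf n : fejer_primitive n (pi / 2) = n%:R * (pi / 2).
Proof.
elim: n => [|n /= ->]; first by rewrite mul0r.
by rewrite dirichlet_primitive_pihalf -natr1; ring.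
Qed.

Lemma fejer_primitive0 n : fejer_primitive n 0 = 0.
Proof.
have D0 m : dirichlet_primitive m 0 = 0.
  by elim: m => //= m ->; rewrite mulr0 sin0 mulr0 addr0.
by elim: n => //= n ->; rewrite D0 addr0.
Qed.

(* [x cos x <= sin x <= x] gives [0 <= 1 / sin^2 x - 1 / x^2 <= 1], to be multiplied
   by [sin^2 (n x) <= 1]. *)
Lemma fejer_kernel_bounds n x : (0 < n)%N -> 0 < x < pi / 2 ->
  n%:R ^+ 2 * sinc (n%:R * x) ^+ 2 <= fejer_kernel n x <=
  n%:R ^+ 2 * sinc (n%:R * x) ^+ 2 + 1.
Proof.
move=> n0 /andP[x0 xpi].
have s0 : 0 < sin x by rewrite sin_gt0_pihalf// x0.
have sx := sin_le (ltW x0).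
have xcs : x * cos x <= sin x by rewrite mulr_cos_le_sin// !ltW.
have c0 : 0 <= cos x by rewrite ltW// cos_gt0_pihalf//; lra.
have kE := fejer_kernelM n x.
set w := n%:R * sinc (n%:R * x).
have wE : w * x = sin (n%:R * x) by rewrite -sincM /w; ring.
have q1 : sin (n%:R * x) ^+ 2 <= 1.
  by rewrite sin2cos2 lerBlDr lerDl sqr_ge0.
rewrite -wE exprMn in kE q1; rewrite -exprMn -/w.
have s2x2 : sin x ^+ 2 <= x ^+ 2 by rewrite ler_pXn2r ?nnegrE// ltW.
have xcs2 : x ^+ 2 <= sin x ^+ 2 + x ^+ 2 * sin x ^+ 2.
  have : (x * cos x) ^+ 2 <= sin x ^+ 2.
    by rewrite ler_pXn2r ?nnegrE ?mulr_ge0// ltW.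
  by rewrite exprMn cos2sin2; lra.
have s20 : 0 < sin x ^+ 2 by rewrite exprn_gt0.
have w20 := sqr_ge0 w.
apply/andP; split; rewrite -(ler_pM2r s20) kE; first by rewrite ler_wpM2l.
apply: (@le_trans _ _ (w ^+ 2 * (sin x ^+ 2 + x ^+ 2 * sin x ^+ 2))).
  by rewrite ler_wpM2l.
rewrite mulrDr mulrDl lerD2l mulrA mul1r -[leRHS]mul1r ler_wpM2r// ltW//.
Qed.

End sinc.

(** * Asymptotics of the primitive [S] of [sinc^2] and of its own primitive [G] *)

Section sinc_primitives.
Context {R : realType}.
Variables S G : R -> R.
Hypotheses (S0 : S 0 = 0) (dS : forall x : R, is_derive x 1 S (sinc x ^+ 2)).
Hypotheses (G0 : G 0 = 0) (dG : forall x : R, is_derive x 1 G (S x)).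

Let d_scaled (n x : R) :
  is_derive x 1 (fun y => n * S (n * y)) (n ^+ 2 * sinc (n * x) ^+ 2).
Proof.
have -> : n ^+ 2 * sinc (n * x) ^+ 2 = n * (sinc (n * x) ^+ 2 * n) by ring.
apply: is_derive_funZ.
exact: (@is_derive_fun_comp _ S _ x _ _ (dS _) (is_derive_mulrl x n)).
Qed.

(** Integrating [fejer_kernel_bounds] over [0, pi/2] traps the Fejer mass n pi/2 between n S(n pi/2)
    and n S(n pi/2) + pi/2; then divide by n. This is where the limit pi/2 of [S] comes from. *)
Lemma sinc_primitive_pihalf n : (0 < n)%N ->
  0 <= pi / 2 - S (n%:R * (pi / 2)) <= pi / 2 / n%:R.
Proof.
move=> n0; have pi0 : 0 <= pi / 2 :> R by rewrite divr_ge0// pi_ge0.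
have n0' : 0 < n%:R :> R by rewrite ltr0n.
have FE : fejer_primitive n (pi / 2) - fejer_primitive n 0 = n%:R * (pi / 2) :> R.
  by rewrite fejer_primitive_pihalf fejer_primitive0 subr0.
have SE : n%:R * S (n%:R * (pi / 2)) - n%:R * S (n%:R * 0) = n%:R * S (n%:R * (pi / 2)).
  by rewrite mulr0 S0 mulr0 subr0.
have dF (x : R) := is_derive_fejer_primitive n x.
have lo : n%:R * S (n%:R * (pi / 2)) <= n%:R * (pi / 2).
  have := @ler_is_derive_increment _ (fun y => n%:R * S (n%:R * y)) _ _ _ _ _ pi0
    (fun x _ => d_scaled n%:R x) (fun x _ => dF x).
  rewrite FE SE; apply => x xpi.
  by have /andP[] := fejer_kernel_bounds n0 xpi.
have hi : n%:R * (pi / 2) <= n%:R * S (n%:R * (pi / 2)) + pi / 2.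
  have dS1 (x : R) : is_derive x 1 (fun y => n%:R * S (n%:R * y) + y)
    (n%:R ^+ 2 * sinc (n%:R * x) ^+ 2 + 1).
    by apply: is_derive_funD => //; exact: is_derive_id.
  have := @ler_is_derive_increment _ _ (fun y => n%:R * S (n%:R * y) + y) _ _ _ _ pi0
    (fun x _ => dF x) (fun x _ => dS1 x).
  rewrite FE addr0 addrAC SE; apply => x xpi.
  by have /andP[] := fejer_kernel_bounds n0 xpi.
apply/andP; split.
  by rewrite subr_ge0 -(ler_pM2l n0').
rewrite ler_pdivlMr// mulrBl ![_ * n%:R]mulrC; lra.
Qed.

(* The correction terms are those of the expansion of [S] at infinity, so that the
   derivative of this function is [O(u^-3)]. *)
Let H (u : R) := S u + (2^-1 * (u ^+ 1)^-1 + 4^-1 * (sin (2 * u) * (u ^+ 2)^-1)).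

(** Write sin^2 u = (1 - cos 2u)/2. The correction 1/(2u) absorbs the mean part 1/(2u^2), and
    sin(2u)/(4u^2) is the boundary term of integrating cos(2u)/(2u^2) by parts. *)
Let dH (u : R) : 0 < u -> is_derive u 1 H (- (sin (2 * u) / (2 * u ^+ 3))).
Proof.
move=> u0; have un0 := lt0r_neq0 u0.
have -> : - (sin (2 * u) / (2 * u ^+ 3)) = sinc u ^+ 2 +
  (2^-1 * (- 1%:R * (u ^+ 2)^-1) + 4^-1 * (sin (2 * u) * (- 2%:R * (u ^+ 3)^-1)
     + (u ^+ 2)^-1 * (cos (2 * u) * 2))).
  rewrite /sinc (negbTE un0) expr_div_n.
  have -> : cos (2 * u) = 1 - 2 * sin u ^+ 2.
    by rewrite mulr_natl cos_mulr2n cos2sin2 -mulr_natl; ring.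
  by field.
have dsin := @is_derive_fun_comp _ sin _ u _ _ (is_derive_sin _) (is_derive_mulrl u 2).
have d1 := is_derive_funZ 2^-1 (is_derive_invX 1 un0).
have d2 := is_derive_funZ 4^-1 (is_derive_funM dsin (is_derive_invX 2 un0)).
exact: is_derive_funD (dS u) (is_derive_funD d1 d2).
Qed.

(** The derivative of [H] is at most x^-3 / 2 in absolute value, so [H] is compared with multiples
    of y^-2 / 4 of both signs. The bound is uniform in [v], which can then go to infinity. *)
Let H_increment (u v : R) : 0 < u -> u <= v ->
  `|H v - H u| <= 4^-1 * (u ^+ 2)^-1.
Proof.
move=> u0 uv.
have pos x : x \in `[u, v] -> 0 < x.
  by rewrite in_itv/= => /andP[ux _]; exact: lt_le_trans ux.
have dI c (x : R) : 0 < x ->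
    is_derive x 1 (fun y : R => c * (y ^+ 2)^-1) (c * (- 2%:R * (x ^+ 3)^-1)).
  by move=> x0; apply/is_derive_funZ/is_derive_invX/lt0r_neq0.
have bound (x : R) : u < x < v -> `|sin (2 * x) / (2 * x ^+ 3)| <= 2^-1 * (x ^+ 3)^-1.
  move=> /andP[ux xv]; have x0 : 0 < x := lt_trans u0 ux.
  rewrite normrM normfV (@ger0_norm _ (2 * _)) ?mulr_ge0 ?exprn_ge0 ?(ltW x0)//.
  by rewrite invfM ler_piMl ?sin_max// mulr_ge0 ?invr_ge0 ?exprn_ge0 ?(ltW x0).
have v2 : 0 <= (v ^+ 2)^-1 by rewrite invr_ge0 sqr_ge0.
have up := @ler_is_derive_increment _ H (fun y : R => (- 4^-1) * (y ^+ 2)^-1) _ _ _ _ uv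
  (fun x xuv => dH (pos _ xuv)) (fun x xuv => dI (- 4^-1) _ (pos _ xuv)).
have {up} : H v - H u <= - 4^-1 * (v ^+ 2)^-1 - - 4^-1 * (u ^+ 2)^-1.
  by apply: up => x /bound; rewrite ler_norml => /andP[? ?]; lra.
have dn := @ler_is_derive_increment _ (fun y : R => 4^-1 * (y ^+ 2)^-1) H _ _ _ _ uv
  (fun x xuv => dI (4^-1) _ (pos _ xuv)) (fun x xuv => dH (pos _ xuv)).
have {dn} : 4^-1 * (v ^+ 2)^-1 - 4^-1 * (u ^+ 2)^-1 <= H v - H u.
  by apply: dn => x /bound; rewrite ler_norml => /andP[? ?]; lra.
by rewrite ler_norml => ? ?; apply/andP; split; lra.
Qed.

(** The constant 3 covers pi/2 < 2 from [sinc_primitive_pihalf] and 1/2 + 1/4 from the two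
    correction terms. *)
Let H_pihalf n : (0 < n)%N -> `|H (n%:R * (pi / 2)) - pi / 2| <= 3 / n%:R.
Proof.
move=> n0; have n0' : 0 < n%:R :> R by rewrite ltr0n.
have /andP[] := sinc_primitive_pihalf n0; rewrite /H; set v := n%:R * (pi / 2).
have n1 : 1 <= n%:R :> R by rewrite ler1n.
have nv : n%:R <= v.
  by rewrite ler_pMr//; have := pihalf_ge1 R.
have v0 : 0 < v by exact: lt_le_trans nv.
have vi : v^-1 <= n%:R^-1 by rewrite lef_pV2.
have v2i : (v ^+ 2)^-1 <= n%:R^-1.
  rewrite (le_trans _ vi)// lef_pV2 ?posrE ?exprn_gt0// expr2 ler_pMr//.
  exact: le_trans nv.
have h1 : `|sin (2 * v) * (v ^+ 2)^-1| <= n%:R^-1.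
  rewrite normrM (@ger0_norm _ (_^-1)) ?invr_ge0 ?sqr_ge0// (le_trans _ v2i)//.
  by rewrite ler_piMl ?sin_max// invr_ge0 sqr_ge0.
have v0i : 0 < v^-1 by rewrite invr_gt0.
have h2 : pi / 2 / n%:R <= 2 / n%:R :> R.
  by rewrite ler_pM2r ?invr_gt0// ltW// pihalf_lt2.
move: h1 h2; rewrite expr1 !ler_norml => /andP[? ?] ? ? ?.
by apply/andP; split; lra.
Qed.

(** Going from [u] out to n pi/2 for large n shows that [H u] is within u^-2 / 4 of pi/2. Dropping
    the oscillating correction costs another u^-2 / 4. *)
Lemma sinc_primitive_asymp (u : R) : 0 < u ->
  `|S u - pi / 2 + (2 * u)^-1| <= 2^-1 * (u ^+ 2)^-1.
Proof.
move=> u0.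
have Hu : `|H u - pi / 2| <= 4^-1 * (u ^+ 2)^-1.
  apply/ler_addgt0Pr => e e0.
  (* Such an n gives both [u <= n pi/2] and [3 / n <= e]. *)
  have [n n0 nu] : exists2 n, (0 < n)%N & u + 3 / e < n%:R.
    by exists (Num.truncn (u + 3 / e)).+1 => //; exact: truncnS_gt.
  have e3 : 0 < 3 / e by rewrite divr_gt0.
  have n0' : 0 < n%:R :> R by rewrite ltr0n.
  have uv : u <= n%:R * (pi / 2).
    have : n%:R <= n%:R * (pi / 2) :> R by rewrite ler_pMr ?pihalf_ge1.
    by lra.
  have ne : 3 / n%:R <= e.
    by rewrite ler_pdivrMr// mulrC -ler_pdivrMr//; lra.
  have h1 := H_increment u0 uv; have h2 := H_pihalf n0.
  have := ler_distD (H (n%:R * (pi / 2))) (H u) (pi / 2).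
  by rewrite (distrC (H u) (H _)); lra.
have : `|4^-1 * (sin (2 * u) * (u ^+ 2)^-1)| <= 4^-1 * (u ^+ 2)^-1.
  rewrite normrM ger0_norm// ler_pM2l// normrM (@ger0_norm _ (_^-1)) ?invr_ge0 ?sqr_ge0//.
  by rewrite ler_piMl ?sin_max// invr_ge0 sqr_ge0.
move: Hu; rewrite /H expr1 invfM !ler_norml => /andP[? ?] /andP[? ?].
by apply/andP; split; lra.
Qed.

(** What [G] retains beyond its linear and logarithmic growth. It enters only through differences,
    in which the constant C of its expansion cancels. *)
Definition sinc_remainder (u : R) := G u - pi / 2 * u + 2^-1 * ln u.

(** The derivative is S(x) - pi/2 + 1/(2x), bounded by x^-2 / 2 through [sinc_primitive_asymp];
    compare with multiples of 1/(2y) of both signs. *)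
Lemma sinc_remainder_increment (u v : R) : 0 < u -> u <= v ->
  `|sinc_remainder v - sinc_remainder u| <= 2^-1 * u^-1.
Proof.
move=> u0 uv.
have pos x : x \in `[u, v] -> 0 < x.
  by rewrite in_itv/= => /andP[ux _]; exact: lt_le_trans ux.
have dI c (x : R) : 0 < x ->
    is_derive x 1 (fun y : R => c * (y ^+ 1)^-1) (c * (- 1%:R * (x ^+ 2)^-1)).
  by move=> x0; apply/is_derive_funZ/is_derive_invX/lt0r_neq0.
have dE (x : R) : 0 < x -> is_derive x 1 sinc_remainder (S x - pi / 2 + 2^-1 * x^-1).
  move=> x0; apply: is_derive_funD; last exact/is_derive_funZ/is_derive1_ln.
  by apply: is_derive_funB => //; exact: is_derive_mulrl.
have bound (x : R) : u < x < v -> `|S x - pi / 2 + 2^-1 * x^-1| <= 2^-1 * (x ^+ 2)^-1.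
  by move=> /andP[ux _]; rewrite -invfM sinc_primitive_asymp// (lt_trans u0).
have vi : 0 <= v^-1 by rewrite invr_ge0 (le_trans _ uv) ?ltW.
have up := @ler_is_derive_increment _ sinc_remainder (fun y : R => (- 2^-1) * (y ^+ 1)^-1)
  _ _ _ _ uv
  (fun x xuv => dE _ (pos _ xuv)) (fun x xuv => dI (- 2^-1) _ (pos _ xuv)).
have {up} : sinc_remainder v - sinc_remainder u
    <= - 2^-1 * (v ^+ 1)^-1 - - 2^-1 * (u ^+ 1)^-1.
  by apply: up => x /bound; rewrite ler_norml => /andP[? ?]; lra.
have dn := @ler_is_derive_increment _ (fun y : R => 2^-1 * (y ^+ 1)^-1) sinc_remainder
  _ _ _ _ uv
  (fun x xuv => dI (2^-1) _ (pos _ xuv)) (fun x xuv => dE _ (pos _ xuv)).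
have {dn} : 2^-1 * (v ^+ 1)^-1 - 2^-1 * (u ^+ 1)^-1 <= sinc_remainder v - sinc_remainder u.
  by apply: dn => x /bound; rewrite ler_norml => /andP[? ?]; lra.
by rewrite !expr1 ler_norml => ? ?; apply/andP; split; lra.
Qed.

Lemma sinc_remainder_cvg (u v : R) : 0 < u -> 0 < v ->
  sinc_remainder (N * u) - sinc_remainder (N * v) @[N --> +oo] --> (0 : R).
Proof.
wlog uv : u v / u <= v.
  move=> h u0 v0; have [uv|/ltW vu] := leP u v; first exact: h.
  rewrite -[0]oppr0 [X in X @ _](_ : _ =
    fun N => - (sinc_remainder (N * v) - sinc_remainder (N * u))).
    by apply: cvgN; exact: h.
  by apply/funext => N; rewrite opprB.
move=> u0 v0; apply/cvgrPdist_le => e e0; near=> N.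
have N0 : 0 < N by near: N; apply: nbhs_pinfty_gt; rewrite num_real.
have NE : (2 * u)^-1 * e^-1 <= N by near: N; apply: nbhs_pinfty_ge; rewrite num_real.
have Nu0 : 0 < N * u by rewrite mulr_gt0.
rewrite sub0r normrN distrC.
apply: le_trans (sinc_remainder_increment Nu0 _) _; first by rewrite ler_pM2l.
rewrite -invfM -[leRHS]invrK lef_pV2 ?posrE ?invr_gt0 ?mulr_gt0//.
by move: NE; rewrite ler_pdivrMl ?mulr_gt0// -mulrA (mulrC u).
Unshelve. all: by end_near. Qed.

(** As [sinc^2] is even, S(-x) + S(x) has zero derivative and vanishes at 0. The same argument one
    level up makes [G] even. *)
Lemma sinc_primitiveN (x : R) : S (- x) = - S x.
Proof.
have dN (y : R) : is_derive y 1 (fun z => S (-1 * z) + S z) 0.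
  have -> : 0 = sinc (-1 * y) ^+ 2 * -1 + sinc y ^+ 2 by rewrite mulN1r sincN; ring.
  apply: is_derive_funD => //.
  exact: (@is_derive_fun_comp _ S _ y _ _ (dS _) (is_derive_mulrl y (-1))).
have := is_derive_0_is_cst x 0 dN; rewrite mulr0 S0 addr0 mulN1r.
by move/eqP; rewrite addr_eq0 => /eqP.
Qed.

Lemma sinc_primitive2N (x : R) : G (- x) = G x.
Proof.
have dN (y : R) : is_derive y 1 (fun z => G (-1 * z) - G z) 0.
  have -> : 0 = S (-1 * y) * -1 - S y by rewrite mulN1r sinc_primitiveN; ring.
  apply: is_derive_funB => //.
  exact: (@is_derive_fun_comp _ G _ y _ _ (dG _) (is_derive_mulrl y (-1))).
have := is_derive_0_is_cst x 0 dN; rewrite mulr0 G0 subr0 mulN1r.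
by move/eqP; rewrite subr_eq0 => /eqP.
Qed.

Lemma sinc_primitive2_norm (x : R) : G `|x| = G x.
Proof. by case: (ger0P x) => // _; rewrite sinc_primitive2N. Qed.

Let mu := @lebesgue_measure R.

(** Inner integral of the two-point density, for which [c] will be pi^-2. A primitive of sinc^2(x -
    y) in y is -S(x - y). *)
Lemma integral_oneB_sinc_sqr (c x r s : R) : r <= s ->
  (\int[mu]_(y in `[r, s]) (c * (1 - sinc (x - y) ^+ 2))%:E =
   (c * (s - r - (S (x - r) - S (x - s))))%:E)%E.
Proof.
move=> rs.
have -> : c * (s - r - (S (x - r) - S (x - s))) =
  c * (s - -1 * S (x - s)) - c * (r - -1 * S (x - r)) by ring.
apply: (@FTC2_is_derive _ (fun y => c * (y - -1 * S (x - y)))) => //.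
- move=> y; apply: cvgM; first exact: cvg_cst.
  apply: cvgB; first exact: cvg_cst.
  apply: (@continuous_comp _ _ _ (fun y => sinc (x - y)) (fun z : R => z ^+ 2)).
    apply: (@continuous_comp _ _ _ (fun y => x - y) sinc); last exact: continuous_sinc.
    by apply: cvgB; [exact: cvg_cst|exact: cvg_id].
  exact: exprn_continuous.
- move=> y.
  have -> : 1 - sinc (x - y) ^+ 2 = 1 - -1 * (sinc (x - y) ^+ 2 * (0 - 1)) by ring.
  have dsub := is_derive_funB (is_derive_cst x y (1 : R)) (is_derive_id y (1 : R)).
  exact: (is_derive_funZ c (is_derive_funB (is_derive_id y (1 : R)) (is_derive_funZ (-1)
    (@is_derive_fun_comp _ S (fun y => x - y) y _ _ (dS (x - y)) dsub)))).
Qed.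

(** Outer integral: integrating [S] once more produces the second difference of [G]. *)
Lemma integral_oneB_sinc_sqr2 (c p q r s : R) : p <= q ->
  (\int[mu]_(x in `[p, q]) (c * (s - r - (S (x - r) - S (x - s))))%:E =
   (c * ((q - p) * (s - r) - (G (q - r) - G (p - r) - (G (q - s) - G (p - s)))))%:E)%E.
Proof.
move=> pq.
have -> : c * ((q - p) * (s - r) - (G (q - r) - G (p - r) - (G (q - s) - G (p - s)))) =
  c * ((s - r) * q - (G (q - r) - G (q - s))) - c * ((s - r) * p - (G (p - r) - G (p - s))).
  by ring.
apply: (@FTC2_is_derive _ (fun x => c * ((s - r) * x - (G (x - r) - G (x - s))))) => //.
- have cS := continuous_is_derive dS; move=> x; apply: cvgM; first exact: cvg_cst.
  apply: cvgB; first exact: cvg_cst.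
  apply: cvgB.
    apply: (@continuous_comp _ _ _ (fun y => y - r) S); last exact: cS.
    by apply: cvgB; [exact: cvg_id|exact: cvg_cst].
  apply: (@continuous_comp _ _ _ (fun y => y - s) S); last exact: cS.
  by apply: cvgB; [exact: cvg_id|exact: cvg_cst].
- move=> x.
  have -> : S (x - r) - S (x - s) = S (x - r) * (1 - 0) - S (x - s) * (1 - 0) by ring.
  have dsub a := is_derive_funB (is_derive_id x (1 : R)) (is_derive_cst a x (1 : R)).
  exact: (is_derive_funZ c (is_derive_funB (is_derive_mulrl x (s - r)) (is_derive_funB
    (@is_derive_fun_comp _ G (fun y => y - r) x _ _ (dG (x - r)) (dsub r))
    (@is_derive_fun_comp _ G (fun y => y - s) x _ _ (dG (x - s)) (dsub s))))).
Qed.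

End sinc_primitives.

(** * Counting particles and pairs of distinct particles *)

Lemma esum_cst_finite (R : realType) (T : choiceType) (D : set T) (c : R) :
  finite_set D -> 0 <= c -> (\esum_(i in D) c%:E = (c * #|` fset_set D|%:R)%:E)%E.
Proof.
move=> finD c0; rewrite esum_fset// fsbig_finite//= sumEFin big_const_seq count_predT.
by rewrite iter_addr_0 mulr_natr.
Qed.

Section counting.
Context {R : realType}.
Implicit Types (X : configuration R) (A B : set R).

Lemma finite_particles X A : bounded_set A -> finite_set (particles X `&` A).
Proof.
move=> [M [_ AM]].
apply: sub_finite_set (locally_finite X (@segment_compact _ (- (M + 1)) (M + 1))).
have M1 : M < M + 1 by rewrite ltrDl.
by apply: setIS => x /(AM _ M1); rewrite /= in_itv/= ler_norml.
Qed.

Lemma esum_particles1 X A : bounded_set A ->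
  (\esum_(x in distinct_tuples 1 X) (\1_A (tnth x ord0))%:E =
   (num_particles A X)%:E :> \bar R)%E.
Proof.
move=> bA.
rewrite (eq_esum (b := fun x : 1.-tuple R =>
    if x \in [set x | A (tnth x ord0)] then 1%:E else 0%E)); last first.
  move=> x _; rewrite indicE.
  have -> : (x \in [set x : 1.-tuple R | A (tnth x ord0)]) = (tnth x ord0 \in A).
    by apply/idP/idP; rewrite !inE.
  by case: ifP.
rewrite -esum_mkcondr (reindex_esum (particles X `&` A) _ (fun y => [tuple y])).
  by rewrite esum_cst_finite ?mul1r//; exact: finite_particles.
split.
- by move=> y [Xy Ay]; split => //; split => // i; rewrite [i]ord1.
- by move=> y z _ _ /(congr1 (fun x => tnth x ord0)).
- move=> x [[_ xX] Ax]; exists (tnth x ord0); first by split => //; exact: xX.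
  by apply: eq_from_tnth => i; rewrite [i]ord1.
Qed.

(** Split the pairs counted by the product into those with distinct entries and the diagonal ones,
    which are the particles in both sets. *)
Lemma esum_particles2 X A B : bounded_set A -> bounded_set B ->
  (\esum_(x in distinct_tuples 2 X) (\1_A (tnth x ord0) * \1_B (tnth x ord_max))%:E +
     (num_particles (A `&` B) X)%:E =
   (num_particles A X * num_particles B X)%:E :> \bar R)%E.
Proof.
move=> bA bB.
have fA := finite_particles X bA; have fB := finite_particles X bB.
pose PA := particles X `&` A; pose PB := particles X `&` B.
(* Distinctness of the pair becomes the removal of [x] from the range of [y]. *)
have -> : (\esum_(x in distinct_tuples 2 X)
    (\1_A (tnth x ord0) * \1_B (tnth x ord_max))%:E =
    \esum_(x in PA) \esum_(y in PB `&` ~` [set x]) 1%:E :> \bar R)%E.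
  rewrite (eq_esum (b := fun x : 2.-tuple R =>
      if x \in [set x | A (tnth x ord0) /\ B (tnth x ord_max)] then 1%:E else 0%E)); last first.
    move=> x _; rewrite !indicE -natrM mulnb.
    have -> : (x \in [set x : 2.-tuple R | A (tnth x ord0) /\ B (tnth x ord_max)]) =
        (tnth x ord0 \in A) && (tnth x ord_max \in B).
      apply/idP/andP => [/set_mem[Ax Bx]|[/set_mem Ax /set_mem Bx]].
        by split; exact: mem_set.
      exact: mem_set.
    by case: ifP.
  rewrite esum_esum; last by move=> *; rewrite lee_fin.
  rewrite -esum_mkcondr (reindex_esum (PA `*`` (fun x => PB `&` ~` [set x])) _
    (fun k => [tuple k.1; k.2]))//.
  split.
  - move=> [y z] [/= [Xy Ay] [[Xz Bz] zy]]; split; last by split.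
    split; first by rewrite /= inE andbT; apply/eqP => yz; apply: zy; rewrite yz.
    by case=> [[|[|//]] i].
  - move=> [y z] [y' z'] _ _ /= h.
    by have := congr1 (fun x => tnth x ord0) h; have := congr1 (fun x => tnth x ord_max) h;
       rewrite /tnth/= => -> ->.
  - move=> x [[ux xX] [Ax Bx]]; exists (tnth x ord0, tnth x ord_max).
      split=> /=; first by split => //; exact: xX.
      split; first by split => //; exact: xX.
      by move=> /(tuple_uniqP _ ux).
    apply: eq_from_tnth => -[[|[|//]] i]; rewrite [LHS](tnth_nth 0) /=;
      congr tnth; exact: val_inj.
have -> : (num_particles (A `&` B) X)%:E =
    (\esum_(x in PA) if x \in B then 1%:E else 0%E)%E :> \bar R.
  by rewrite -esum_mkcondr /PA -setIA esum_cst_finite ?mul1r// setIA; exact: finite_setIl.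
rewrite -esumD; last 2 first.
- by move=> x _; apply: esum_ge0 => *; rewrite lee_fin.
- by move=> x _; case: ifP.
(* For a fixed particle [x] of [A], the particles of [B] other than [x], plus one if [x] lies in
   [B], are all the particles of [B]. *)
rewrite (eq_esum (b := fun=> (num_particles B X)%:E)); last first.
  move=> x [Xx Ax].
  have -> : (num_particles B X)%:E = (\esum_(y in PB) 1%:E)%E :> \bar R.
    by rewrite esum_cst_finite// mul1r.
  rewrite [RHS](esumID [set x]); last by move=> *; rewrite lee_fin.
  rewrite addeC; congr (_ + _)%E.
  have [/set_mem Bx|/negP Bx] := boolP (x \in B).
    have -> : PB `&` [set x] = [set x].
      by apply/seteqP; split => [y []//|y /= ->].
    by rewrite esum_set1// lee_fin.
  have -> : PB `&` [set x] = set0.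
    apply/seteqP; split => // y [[Xy By] /= yx].
    by apply: Bx; rewrite -yx mem_set.
  by rewrite esum_set0.
by rewrite esum_cst_finite// mulrC.
Qed.

(** Counts are natural numbers, so any preimage is a countable union of generating events. *)
Lemma measurable_num_particles A : measurable A -> bounded_set A ->
  measurable_fun [set: conf_space R] (num_particles A : conf_space R -> R).
Proof.
move=> mA bA _ Y mY; rewrite setTI.
have -> : num_particles A @^-1` Y =
    \bigcup_(k in [set k : nat | Y k%:R]) [set X : conf_space R | num_particles A X = k%:R].
  apply/seteqP; split => [X YX|X [k Yk /= ->//]].
  by exists #|` fset_set (particles X `&` A)|.
apply: bigcup_measurable => k _; apply: sub_sigma_algebra.
by exists A, k.
Qed.

End counting.

(** * First and second moments of counts under the sine-process *)

Lemma det_mx22 (K : comRingType) (M : 'M[K]_2) :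
  \det M = M ord0 ord0 * M ord_max ord_max - M ord0 ord_max * M ord_max ord0.
Proof.
rewrite (expand_det_row _ ord0) !big_ord_recl big_ord0 /cofactor !det_mx11 !mxE /=.
rewrite addr0 expr0 expr1 !mul1r mulN1r mulrN.
by congr (M _ _ * M _ _ - M _ _ * M _ _); exact: val_inj.
Qed.

Section sine_process_moments.
Context {R : realType}.
Variables (P : probability (conf_space R) R) (hP : sine_process P).

Let mu := @lebesgue_measure R.

Lemma bounded_itvcc (p q : R) : bounded_set (`[p, q]%classic : set R).
Proof. exact/compact_bounded/segment_compact. Qed.

Lemma sine_kernel_diag (x : R) : sine_kernel x x = pi^-1.
Proof. by rewrite /sine_kernel eqxx. Qed.

(** The maximum with 0 admits an empty interval, as arises when this is applied to the intersection
    of two disjoint intervals. *)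
Lemma integral_num_particles (p q : R) :
  (\int[P]_X (num_particles `[p, q] X)%:E = (pi^-1 * Num.max 0 (q - p))%:E)%E.
Proof.
have bA := bounded_itvcc p q.
pose f (x : 1.-tuple R) : \bar R := (\1_(`[p, q]) (tnth x ord0))%:E.
have f0 x : (0 <= f x)%E by rewrite lee_fin indicE.
have mf : measurable_fun setT f.
  have mA : measurable_fun setT (\1_(`[p, q]) : R -> R) by exact: measurable_indic.
  have mt : measurable_fun setT (fun x : 1.-tuple R => tnth x ord0).
    by exact: measurable_tnth.
  apply/measurable_EFinP; exact: (measurableT_comp mA mt).
have := hP mf f0.
under eq_integral => X _ do rewrite esum_particles1//.
move=> ->; rewrite /f /=.
under eq_integral => x _.
  rewrite det_mx11 mxE sine_kernel_diag (tnth_nth 0) /= -EFinM.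
  over.
transitivity (\int[mu]_(x in `[p, q]) (pi^-1 : R)%:E)%E.
  rewrite [RHS]integral_mkcond; apply: eq_integral => x _.
  rewrite patchE indicE; case: ifP => _; first by rewrite mul1r.
  by rewrite mul0r.
have [pq|qp] := leP p q.
  rewrite (max_r _) ?subr_ge0// mulrBr.
  apply: (@FTC2_is_derive _ (fun x => pi^-1 * x)) => //; last first.
    by move=> x; exact: is_derive_mulrl.
  by move=> x; exact: cvg_cst.
rewrite set_itv_ge ?bnd_simp -?ltNge// integral_set0 max_l ?mulr0//.
by rewrite subr_le0 ltW.
Qed.

Lemma pair_density (x y : R) :
  \det (\matrix_(i < 2, j < 2) sine_kernel (tnth [tuple x; y] i) (tnth [tuple x; y] j)) =
  pi^-1 ^+ 2 * (1 - sinc (x - y) ^+ 2).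
Proof.
rewrite det_mx22 !mxE !(tnth_nth 0) /= !sine_kernel_diag !sine_kernelE.
by rewrite -(opprB x y) sincN; ring.
Qed.

Section product_moment.
Variables S G : R -> R.
Hypotheses (dS : forall x : R, is_derive x 1 S (sinc x ^+ 2)).
Hypotheses (dG : forall x : R, is_derive x 1 G (S x)).

(** By [esum_particles2], the two-point function integrates the pairs of distinct particles, and the
    one-point function integrates the count of the overlap. *)
Lemma integral_num_particlesM (p q r s : R) : p <= q -> r <= s ->
  (\int[P]_X (num_particles `[p, q] X * num_particles `[r, s] X)%:E =
   (pi^-1 ^+ 2 * ((q - p) * (s - r) - (G (q - r) - G (p - r) - (G (q - s) - G (p - s))))
    + pi^-1 * Num.max 0 (Num.min q s - Num.max p r))%:E)%E.
Proof.
move=> pq rs.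
set A := `[p, q]%classic; set B := `[r, s]%classic.
have bA : bounded_set A := bounded_itvcc p q.
have bB : bounded_set B := bounded_itvcc r s.
have AB : A `&` B = `[Num.max p r, Num.min q s]%classic.
  rewrite /A /B; apply/seteqP; split => x /=; rewrite !in_itv/= ge_max le_min.
    by move=> [/andP[-> ->] /andP[-> ->]].
  by move=> /andP[/andP[-> ->] /andP[-> ->]].
pose f (x : 2.-tuple R) : \bar R := (\1_A (tnth x ord0) * \1_B (tnth x ord_max))%:E.
have f0 x : (0 <= f x)%E by rewrite /f lee_fin !indicE -natrM.
have mIA : measurable A by exact: measurable_itv.
have mIB : measurable B by exact: measurable_itv.
have iA : measurable_fun setT (\1_A : R -> R) by exact: measurable_indic.
have iB : measurable_fun setT (\1_B : R -> R) by exact: measurable_indic.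
have mt i : measurable_fun setT (fun x : 2.-tuple R => tnth x i).
  by exact: measurable_tnth.
have mf : measurable_fun setT f.
  apply/measurable_EFinP; apply: measurable_funM.
    exact: measurableT_comp iA (mt ord0).
  exact: measurableT_comp iB (mt ord_max).
have mA : measurable_fun [set: conf_space R] (num_particles A : conf_space R -> R).
  exact: measurable_num_particles.
have mB : measurable_fun [set: conf_space R] (num_particles B : conf_space R -> R).
  exact: measurable_num_particles.
have bAB : bounded_set (A `&` B) by rewrite AB; exact: bounded_itvcc.
have mAB : measurable_fun [set: conf_space R]
    (num_particles (A `&` B) : conf_space R -> R).
  by apply: measurable_num_particles => //; exact: measurableI.
(* Solving for the pair sum in terms of counts gives its measurability. *)
have E2 X : (\esum_(x in distinct_tuples 2 X) f x =
    (num_particles A X * num_particles B X - num_particles (A `&` B) X)%:E)%E.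
  have := esum_particles2 X bA bB; rewrite -/f EFinB => <-.
  by rewrite addeK.
have ge0E2 (X : conf_space R) : (0 <= \esum_(x in distinct_tuples 2 X) f x)%E.
  by apply: esum_ge0.
transitivity (\int[P]_X ((\esum_(x in distinct_tuples 2 X) f x) +
    (num_particles (A `&` B) X)%:E))%E.
  by apply: eq_integral => X _; rewrite esum_particles2.
have mE2 : measurable_fun [set: conf_space R]
    (fun X : conf_space R => \esum_(x in distinct_tuples 2 X) f x)%E.
  rewrite (funext E2); apply/measurable_EFinP; apply: measurable_funB => //.
  exact: measurable_funM.
have n0 (X : conf_space R) : (0 <= (num_particles (A `&` B) X)%:E)%E.
  by rewrite lee_fin ler0n.
rewrite ge0_integralD//; last exact/measurable_EFinP.
rewrite AB integral_num_particles EFinD; congr (_ + _)%E.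
rewrite (hP mf f0) /=.
transitivity (\int[mu]_(x in A) (pi^-1 ^+ 2 * (s - r - (S (x - r) - S (x - s))))%:E)%E;
  last exact: integral_oneB_sinc_sqr2.
rewrite [RHS]integral_mkcond; apply: eq_integral => x _.
under eq_integral => y _.
  rewrite (_ : cons_tuple x (cons_tuple y [tuple]) = [tuple x; y]); last exact/val_inj.
  rewrite pair_density /f !(tnth_nth 0)/= !indicE -EFinM.
  over.
rewrite patchE; case: ifP => xA; last first.
  by rewrite integral0_eq// => y _; rewrite mul0r mul0r.
rewrite -(integral_oneB_sinc_sqr dS)// [RHS]integral_mkcond.
apply: eq_integral => y _; rewrite patchE mul1r.
by case: ifP => _; rewrite ?mul1r ?mul0r.
Qed.

(** The term (q - p)(s - r) pi^-2 of the mixed moment is the product of the means and cancels. *)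
Lemma covariance_num_particles (p q r s : R) : p <= q -> r <= s ->
  covariance P (num_particles `[p, q]) (num_particles `[r, s]) =
  (pi^-1 * Num.max 0 (Num.min q s - Num.max p r) -
   pi^-1 ^+ 2 * (G (q - r) - G (p - r) - (G (q - s) - G (p - s))))%:E.
Proof.
move=> pq rs.
(* A nonnegative measurable function with finite integral is integrable; this serves both counts and
   their product, as [covarianceE] demands. *)
have L1 (f : conf_space R -> R) c : measurable_fun [set: conf_space R] f ->
    (forall X, 0 <= f X) -> (\int[P]_X (f X)%:E = c%:E)%E -> f \in Lfun P 1.
  move=> mf f0 fc; apply/Lfun1_integrable/integrableP; split; first exact/measurable_EFinP.
  by under eq_integral => X _ do rewrite /= ger0_norm//; rewrite fc ltry.
have n0 (A : set R) X : 0 <= num_particles A X by rewrite ler0n.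
have mN p' q' : measurable_fun [set: conf_space R]
    (num_particles `[p', q'] : conf_space R -> R).
  by apply: measurable_num_particles => //; exact: bounded_itvcc.
rewrite covarianceE.
- rewrite unlock integral_num_particlesM// !integral_num_particles.
  set ov := Num.max 0 (Num.min _ _ - _); rewrite !max_r ?subr_ge0//.
  have e (x y z : R) : (x%:E - y%:E * z%:E)%E = (x - y * z)%:E by [].
  by rewrite e; congr (_%:E); ring.
- by apply: L1 (integral_num_particles p q).
- by apply: L1 (integral_num_particles r s).
- apply: L1 (integral_num_particlesM pq rs); first exact: measurable_funM.
  by move=> X; rewrite mulr_ge0.
Qed.

End product_moment.
End sine_process_moments.

(** Puts the overlap in the form of a second difference of |u|/2, ready to cancel the linear part of
    [G]. Both sides are piecewise linear, so the sign cases suffice. *)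
Lemma overlap_length (R : realType) (p q r s : R) : p <= q -> r <= s ->
  Num.max 0 (Num.min q s - Num.max p r) =
  2^-1 * (`|q - r| + `|p - s| - `|q - s| - `|p - r|).
Proof.
move=> pq rs.
case: (leP 0 (Num.min q s - Num.max p r)); case: (leP q s) => ?; case: (leP p r) => ? ?;
case: (ger0P (q - r)) => ?; case: (ger0P (p - s)) => ?;
case: (ger0P (q - s)) => ?; case: (ger0P (p - r)) => ?; lra.
Qed.

(** * The limit of the covariance *)

Unset Implicit Arguments.
Set Strict Implicit.
Set Printing Implicit Defensive.

Theorem proposition1p8 (R : realType) (P : probability (conf_space R) R)
    (hP : sine_process P) (a b t s : R)
    (ha : a != 0) (hb : b != 0) (hab : a < b) (ht : 0 < t) (hs : 0 < s)
    (hts : t != s) (hatbs : a * t != b * s) (hbtas : b * t != a * s) :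
  covariance P (num_particles `[a * N * t, b * N * t])
               (num_particles `[a * N * s, b * N * s]) @[N --> +oo]
    --> (pi^-1 * (log_covariance (a * t) (a * s) + log_covariance (b * t) (b * s)
                  - log_covariance (a * t) (b * s)
                  - log_covariance (b * t) (a * s)))%:E.
Proof.
have csinc2 : continuous (fun u : R => sinc u ^+ 2).
  move=> u; apply: (@continuous_comp _ _ _ sinc (fun z : R => z ^+ 2)).
    exact: continuous_sinc.
  exact: exprn_continuous.
have [S [S0 dS]] := continuous_primitive csinc2.
have [G [G0 dG]] := continuous_primitive (continuous_is_derive dS).
pose E := sinc_remainder G.
have GE (u : R) : G u = E `|u| + pi / 2 * `|u| - 2^-1 * ln `|u|.
  by rewrite /E /sinc_remainder (sinc_primitive2_norm S0 dS G0 dG); ring.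
have pos (x y : R) : x != y -> 0 < `|x - y| by rewrite normr_gt0 subr_eq0.
(* All four endpoint distances must be positive, for the logarithms and for [sinc_remainder_cvg];
   [ha] and [hb] carry [t != s] over to the endpoints. *)
have pr : 0 < `|a * t - a * s|.
  by apply: pos; apply: contra hts => /eqP /(mulfI ha) ->.
have qs : 0 < `|b * t - b * s|.
  by apply: pos; apply: contra hts => /eqP /(mulfI hb) ->.
have ps := pos _ _ hatbs; have qr := pos _ _ hbtas.
set l := (X in _ --> X%:E).
(* For [N > 0] the covariance equals [g N] exactly; only differences of remainders separate it from
   the limit. *)
pose g N := l - pi^-1 ^+ 2 * ((E (N * `|b * t - a * s|) - E (N * `|a * t - a * s|))
  - (E (N * `|b * t - b * s|) - E (N * `|a * t - b * s|))).
have gl : g N @[N --> +oo] --> l.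
  rewrite -[X in _ --> X]subr0 -[X in _ - X](mulr0 (pi^-1 ^+ 2)) -[X in _ * X](subr0 0).
  apply: cvgB; first exact: cvg_cst.
  apply: cvgM; first exact: cvg_cst.
  by apply: cvgB; exact: sinc_remainder_cvg.
have : (g N)%:E @[N --> +oo] --> l%:E by apply: cvg_EFin => //; near=> N.
apply: cvg_trans; apply: near_eq_cvg; near=> N.
have N0 : 0 < N by near: N; apply: nbhs_pinfty_gt; rewrite num_real.
have dist (x y u v : R) : `|x * N * u - y * N * v| = N * `|x * u - y * v|.
  by rewrite -[X in _ = X * _](gtr0_norm N0) -normrM; congr `|_|; ring.
have le u : 0 < u -> a * N * u <= b * N * u.
  by move=> u0; rewrite !ler_wpM2r// ltW.
rewrite (covariance_num_particles hP dS dG (le _ ht) (le _ hs)).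
(* The linear terms cancel against the overlap, and the four copies of [ln N] cancel by the signs of
   the second difference. *)
rewrite (overlap_length (le _ ht) (le _ hs)) !GE !dist !lnM ?posrE//.
congr (_%:E); rewrite /g /l /log_covariance.
move: (@pi R) (lt0r_neq0 (pi_gt0 R)) => c c0.
by field.
Unshelve. all: by end_near. Qed.
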